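(* Let $\Omega$ be a set and let $Q$ index a join-sub-semilattice $\{\mathcal{P}_x : x\in Q\}$ of $(Part(\Omega),\leq)$. The labeled information algebras $\Psi(\Omega)$ and $\tilde{\Psi}(\Omega)$ are isomorphic; that is, there is a bijection $\Psi(\Omega)\to\tilde{\Psi}(\Omega)$ that preserves labeling, combination and all transport operations $t_y$, $y\in Q$.
   Context: Gambles. A gamble on a set $\Omega$ is a bounded function $f:\Omega\to\mathbb{R}$; $\mathcal{L}=\mathcal{L}(\Omega)$ is the set of all gambles and $\mathcal{L}^+:=\{f\in\mathcal{L}: f\geq 0, f\neq 0\}$. A set $\mathcal{D}\subseteq\mathcal{L}$ is coherent if (D1) $\mathcal{L}^+\subseteq\mathcal{D}$; (D2) the zero gamble is not in $\mathcal{D}$; (D3) $f,g\in\mathcal{D}$ implies $f+g\in\mathcal{D}$; (D4) $f\in\mathcal{D},\lambda>0$ implies $\lambda f\in\mathcal{D}$. $C(\Omega)$ is the family of coherent sets and $\Phi(\Omega):=C(\Omega)\cup\{\mathcal{L}(\Omega)\}$. For $\mathcal{D}'\subseteq\mathcal{L}$, $\mathcal{C}(\mathcal{D}'):=\bigcap\{\mathcal{D}\in\Phi(\Omega):\mathcal{D}'\subseteq\mathcal{D}\}$. Partitions and questions. $Part(\Omega)$ is the set of partitions of $\Omega$, ordered by: $\mathcal{P}\leq\mathcal{P}'$ iff every block of $\mathcal{P}'$ is contained in a block of $\mathcal{P}$ (finer is larger). The join $\mathcal{P}\vee\mathcal{P}'$ consists of the non-empty intersections of blocks of $\mathcal{P}$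 with blocks of $\mathcal{P}'$. A family of partitions is indexed bijectively by $Q$ as $\{\mathcal{P}_x:x\in Q\}$, and $x\vee y$ is the index with $\mathcal{P}_{x\vee y}=\mathcal{P}_x\vee\mathcal{P}_y$. $\mathcal{L}_x$ is the set of gambles that are constant on every block of $\mathcal{P}_x$. Operations on $\Phi(\Omega)$. Combination $\mathcal{D}_1\cdot\mathcal{D}_2:=\mathcal{C}(\mathcal{D}_1\cup\mathcal{D}_2)$; extraction $\epsilon_x(\mathcal{D}):=\mathcal{C}(\mathcal{D}\cap\mathcal{L}_x)$. The element $x\in Q$ is a support of $\mathcal{D}$ if $\epsilon_x(\mathcal{D})=\mathcal{D}$. The algebra $\Psi(\Omega)$: $\Psi(\Omega):=\bigcup_{x\in Q}\Psi_x$, where $\Psi_x$ is the set of pairs $(\mathcal{D},x)$ with $\mathcal{D}\in\Phi(\Omega)$ and $x$ a support of $\mathcal{D}$. Operations: labeling $d(\mathcal{D},x):=x$; combination $(\mathcal{D}_1,x)\cdot(\mathcal{D}_2,y):=(\mathcal{D}_1\cdot\mathcal{D}_2,x\vee y)$; transport $t_y(\mathcal{D},x):=(\epsilon_y(\mathcal{D}),y)$. The algebra $\tilde{\Psi}(\Omega)$: $\tilde{\Psi}(\Omega):=\bigcup_{x\in Q}\tilde{\Psi}_x$, where $\tilde{\Psi}_x$ is the set of all pairs $(\mathcal{D}\cap\mathcal{L}_x,x)$ with $\mathcal{D}\in\Phi(\Omega)$. Operations: labeling $d(\mathcal{D}\cap\mathcal{L}_x,x):=x$; combination $(\mathcal{D}_1\cap\mathcal{L}_x,x)\cdot(\mathcal{D}_2\cap\mathcal{L}_y,y):=\big((\mathcal{C}(\mathcal{D}_1\cap\mathcal{L}_x)\cdot\mathcal{C}(\mathcal{D}_2\cap\mathcal{L}_y))\cap\mathcal{L}_{x\vee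 y},\,x\vee y\big)$, where the inner $\cdot$ is combination in $\Phi(\Omega)$; transport $t_y(\mathcal{D}\cap\mathcal{L}_x,x):=(\mathcal{C}(\mathcal{D}\cap\mathcal{L}_x)\cap\mathcal{L}_y,\,y)$. *)

(* Defs.v *)
From mathcomp Require Import all_boot all_order all_algebra.
From mathcomp Require Import all_classical all_reals all_analysis.

Set Implicit Arguments.
Unset Strict Implicit.
Unset Printing Implicit Defensive.

Import Order.TTheory GRing.Theory Num.Theory.
Import numFieldNormedType.Exports.

Local Open Scope classical_set_scope.
Local Open Scope ring_scope.

Section Gambles.
Context (R : realType) (Omega : Type).
Implicit Types (f g : Omega -> R) (D : set (Omega -> R)).

Definition gambles : set (Omega -> R) := [set f | bounded_fun f].

Definition pos_gambles : set (Omega -> R) :=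
  [set f | [/\ gambles f, forall w, 0 <= f w & f <> 0]].

Record coherent D : Prop := Coherent {
  coherent_sub : D `<=` gambles ;
  coherent_pos : pos_gambles `<=` D ;
  coherent_zero : ~ D 0 ;
  coherent_add : forall f g, D f -> D g -> D (f + g) ;
  coherent_scale : forall f (l : R), D f -> 0 < l -> D (l *: f) }.

Definition Phi : set (set (Omega -> R)) := coherent `|` [set gambles].

Definition closure_of D' : set (Omega -> R) :=
  \bigcap_(D in [set D | Phi D /\ D' `<=` D]) D.

Definition combine_Phi D1 D2 := closure_of (D1 `|` D2).

End Gambles.

Section Partitions.
Context (Omega : Type).
Implicit Types (P : set (set Omega)).

(* A partition is given by the set of its blocks, the blocks being indexed by
   themselves. *)
Definition is_partition P := classical_sets.partition P id setT.

(* le_part P P' : P' is finer than P. *)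
Definition le_part P P' :=
  forall B', P' B' -> exists2 B, P B & B' `<=` B.

Definition join_part P P' : set (set Omega) :=
  [set C | C !=set0 /\ exists B B', [/\ P B, P' B' & C = B `&` B']].

Lemma join_part_partition P P' :
  is_partition P -> is_partition P' -> is_partition (join_part P P').
Proof.
move=> [cP tP nP] [cP' tP' nP']; split.
- apply/seteqP; split=> // w _.
  have [B PB Bw] : cover P id w by rewrite cP.
  have [B' PB' Bw'] : cover P' id w by rewrite cP'.
  exists (B `&` B') => //; split; first by exists w.
  by exists B, B'.
- move=> _ _ [_ [B1 [B1' [PB1 PB1' ->]]]] [_ [B2 [B2' [PB2 PB2' ->]]]].
  move=> [w [[w1 w1'] [w2 w2']]].
  have -> : B1 = B2 by apply: tP => //; exists w.
  by have -> : B1' = B2' by apply: tP' => //; exists w.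
- by move=> C [].
Qed.

Lemma join_part_lub P P' S : is_partition S ->
  le_part (join_part P P') S <-> le_part P S /\ le_part P' S.
Proof.
move=> [_ _ nS]; split=> [h|[h h'] B SB].
  split=> B SB; have [_ [_ [C [C' [PC PC' ->]]]] sB] := h _ SB.
    by exists C => // w /sB[].
  by exists C' => // w /sB[].
have [[C PC sC] [C' PC' sC']] := (h _ SB, h' _ SB).
have sB : B `<=` C `&` C' by move=> w Bw; split; [exact: sC|exact: sC'].
exists (C `&` C') => //; split; last by exists C, C'.
by have [w /sB ?] := nS _ SB; exists w.
Qed.

(* A family of partitions of Omega indexed bijectively by Q and closed under
   joins, i.e. a join-sub-semilattice of the partitions of Omega; qjoin x y is
   the index of the join of the partitions indexed by x and y, which is unique
   by injectivity. *)
Record question_family (Q : Type) := QuestionFamily {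
  qpart :> Q -> set (set Omega) ;
  qpart_partition : forall x, is_partition (qpart x) ;
  qpart_inj : injective qpart ;
  qjoin : Q -> Q -> Q ;
  qpart_join : forall x y, qpart (qjoin x y) = join_part (qpart x) (qpart y) }.

End Partitions.

(* The operations of a labeled information algebra, without its axioms. *)
Record labeled_algebra (Q : Type) := LabeledAlgebra {
  carrier :> Type ;
  label : carrier -> Q ;
  combine : carrier -> carrier -> carrier ;
  transport : Q -> carrier -> carrier }.

Record labeled_iso (Q : Type) (A B : labeled_algebra Q) (h : A -> B) : Prop :=
  LabeledIso {
    iso_bij : bijective h ;
    iso_label : forall u, label (h u) = label u ;
    iso_combine : forall u v, h (combine u v) = combine (h u) (h v) ;
    iso_transport : forall y u, h (transport y u) = transport y (h u) }.

Section Algebras.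
Context (R : realType) (Omega Q : Type) (F : question_family Omega Q).
Implicit Types (D A : set (Omega -> R)) (x y : Q).
Implicit Types (p q : set (Omega -> R) * Q).

Definition gambles_at x : set (Omega -> R) :=
  [set f | gambles f /\
           forall B, F x B -> forall w w', B w -> B w' -> f w = f w'].

Definition extract x D := closure_of (D `&` gambles_at x).

Definition is_support x D := extract x D = D.

Definition Psi_at x : set (set (Omega -> R) * Q) :=
  [set (D, x) | D in [set D | Phi D /\ is_support x D]].

Definition Psi := \bigcup_x Psi_at x.

Definition Psi_combine p q :=
  (combine_Phi p.1 q.1, qjoin F p.2 q.2).

Definition Psi_transport y p := (extract y p.1, y).

Definition tPsi_at x : set (set (Omega -> R) * Q) :=
  [set (D `&` gambles_at x, x) | D in @Phi R Omega].

Definition tPsi := \bigcup_x tPsi_at x.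

(* The first component of an element of tPsi is already of the form
   D `&` gambles_at x, so the operations take the closure of it directly. *)
Definition tPsi_combine p q :=
  (combine_Phi (closure_of p.1) (closure_of q.1)
     `&` gambles_at (qjoin F p.2 q.2),
   qjoin F p.2 q.2).

Definition tPsi_transport y p := (closure_of p.1 `&` gambles_at y, y).

Lemma closure_of_sup A : A `<=` closure_of A.
Proof. by move=> f Af D [_]; exact. Qed.

Lemma closure_of_min A D : Phi D -> A `<=` D -> closure_of A `<=` D.
Proof. by move=> PD AD f; apply. Qed.

Lemma closure_of_mono A D : A `<=` D -> closure_of A `<=` closure_of D.
Proof. by move=> AD f Af E [PE DE]; apply: Af; split=> // g /AD/DE. Qed.

Lemma Phi_gambles D : Phi D -> D `<=` @gambles R Omega.
Proof. by move=> [[]//|->]. Qed.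

Lemma Phi_closure A : A `<=` @gambles R Omega -> Phi (closure_of A).
Proof.
move=> AL; case: (pselect (exists2 D, coherent D & A `<=` D)) => [[D cD AD]|nD].
- left; split.
  + by apply: subset_trans (coherent_sub cD); apply: closure_of_min => //; left.
  + by move=> f pf E [[cE|->] _]; [exact: (coherent_pos cE)|case: pf].
  + move=> c0; apply: (coherent_zero cD); apply: c0.
    by split=> //; left.
  + move=> f g cf cg E [PE AE].
    have [fE gE] : E f /\ E g by split; [apply: cf|apply: cg].
    case: PE => [cE|EL]; first exact: (coherent_add cE).
    by move: fE gE; rewrite EL /gambles /=; exact: bounded_funD.
  + move=> f l cf l0 E [PE AE].
    have fE : E f by apply: cf.
    case: PE => [cE|EL]; first exact: (coherent_scale cE).
    move: fE; rewrite EL => -[M [Mreal fM]].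
    exists (l * M); split=> [|N lMN w _]; first exact: num_real.
    rewrite /= normrM (gtr0_norm l0) -ler_pdivlMl// mulrC.
    by apply: fM => //; rewrite ltr_pdivlMr// mulrC.
- right; apply/seteqP; split; first by apply: closure_of_min => //; right.
  by move=> f Lf E [[cE|->] AE] //; case: nD; exists E.
Qed.

Lemma closure_of_id D : Phi D -> closure_of D = D.
Proof.
by move=> PD; apply/seteqP; split;
  [exact: closure_of_min|exact: closure_of_sup].
Qed.

Lemma Phi_extract x D : Phi (extract x D).
Proof. by apply: Phi_closure => f [_ []]. Qed.

Lemma extract_support x D : is_support x (extract x D).
Proof.
apply/seteqP; split.
  by apply: closure_of_min; [exact: Phi_extract|move=> f []].
by apply: closure_of_mono => f [Df xf]; split=> //; apply: closure_of_sup.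
Qed.

Lemma Phi_combine D1 D2 : D1 `<=` @gambles R Omega -> D2 `<=` @gambles R Omega ->
  Phi (combine_Phi D1 D2).
Proof. by move=> h1 h2; apply: Phi_closure => f [/h1|/h2]. Qed.

Lemma gambles_at_joinl x y : gambles_at x `<=` gambles_at (qjoin F x y).
Proof.
move=> f [Lf cf]; split=> // C; rewrite qpart_join => -[_ [B [B' [xB _ ->]]]].
by move=> w w' [Bw _] [Bw' _]; apply: cf Bw Bw'.
Qed.

Lemma gambles_at_joinr x y : gambles_at y `<=` gambles_at (qjoin F x y).
Proof.
move=> f [Lf cf]; split=> // C; rewrite qpart_join => -[_ [B [B' [_ yB ->]]]].
by move=> w w' [_ Bw] [_ Bw']; apply: cf Bw Bw'.
Qed.

Lemma Psi_combine_closed p q : Psi p -> Psi q -> Psi (Psi_combine p q).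
Proof.
move=> [x _ [D1 [P1 s1] <-]] [y _ [D2 [P2 s2] <-]].
exists (qjoin F x y) => //; exists (combine_Phi D1 D2) => //=.
have P12 : Phi (combine_Phi D1 D2) by apply: Phi_combine; exact: Phi_gambles.
split=> //; apply/seteqP; split; first by apply: closure_of_min => // f [].
apply: closure_of_min; first exact: Phi_extract.
move=> f [|].
- rewrite -{1}s1; apply: closure_of_mono => g [Dg xg]; split.
    by apply: closure_of_sup; left.
  exact: gambles_at_joinl.
- rewrite -{1}s2; apply: closure_of_mono => g [Dg yg]; split.
    by apply: closure_of_sup; right.
  exact: gambles_at_joinr.
Qed.

Lemma Psi_transport_closed y p : Psi (Psi_transport y p).
Proof.
exists y => //; exists (extract y p.1) => //.
by split; [exact: Phi_extract|exact: extract_support].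
Qed.

Lemma tPsi_gambles p : tPsi p -> p.1 `<=` @gambles R Omega.
Proof. by move=> [x _ [D _ <-]] f [_ []]. Qed.

Lemma tPsi_combine_closed p q : tPsi p -> tPsi q -> tPsi (tPsi_combine p q).
Proof.
move=> tp tq; exists (qjoin F p.2 q.2) => //; eexists; last by [].
by apply: Phi_combine; apply/Phi_gambles/Phi_closure/tPsi_gambles.
Qed.

Lemma tPsi_transport_closed y p : tPsi p -> tPsi (tPsi_transport y p).
Proof.
move=> tp; exists y => //; exists (closure_of p.1) => //.
exact/Phi_closure/tPsi_gambles.
Qed.

Definition Psi_algebra : labeled_algebra Q := {|
  carrier := {p | Psi p} ;
  label u := (sval u).2 ;
  combine u v := exist _ (Psi_combine (sval u) (sval v))
                         (Psi_combine_closed (svalP u) (svalP v)) ;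
  transport y u := exist _ (Psi_transport y (sval u))
                           (Psi_transport_closed y (sval u)) |}.

Definition tPsi_algebra : labeled_algebra Q := {|
  carrier := {p | tPsi p} ;
  label u := (sval u).2 ;
  combine u v := exist _ (tPsi_combine (sval u) (sval v))
                         (tPsi_combine_closed (svalP u) (svalP v)) ;
  transport y u := exist _ (tPsi_transport y (sval u))
                           (tPsi_transport_closed y (svalP u)) |}.

End Algebras.

Arguments Psi_algebra R {Omega Q} F.
Arguments tPsi_algebra R {Omega Q} F.

(* Main.v *)
(** The isomorphism restricts a pair [(D, x)] to [(D `&` L_x, x)], with inverse
    [(A, x) |-> (C(A), x)]. Both composites are identities: the first because
    [x] supports [D], the second because [C(D `&` L_x)] lies between
    [D `&` L_x] and [D]. *)

Require Import Defs.
From mathcomp Require Import all_boot all_order all_algebra.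
From mathcomp Require Import all_classical all_reals all_analysis.

Local Open Scope classical_set_scope.

Section Restriction.
Context {R : realType} {Omega Q : Type} (F : question_family Omega Q).
Implicit Types (x y : Q) (p q : set (Omega -> R) * Q).

(** As a member of [Phi], [D] is one of the sets intersected to form the closure, so extraction adds
    nothing outside [D]. *)
Lemma extract_gambles_at x (D : set (Omega -> R)) : Phi D ->
  extract F x D `&` gambles_at F x = D `&` gambles_at F x.
Proof.
move=> PD; apply/seteqP; split=> f [Df xf]; split=> //.
  by move: Df; apply: closure_of_min => // g [].
exact: closure_of_sup.
Qed.

Lemma Psi_Phi p : Psi F p -> Phi p.1.
Proof. by case=> x _ [D [PD _] <-]. Qed.

Lemma Psi_extract p : Psi F p -> extract F p.2 p.1 = p.1.
Proof. by case=> x _ [D [_ sD] <-]. Qed.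

Definition restrict p := (p.1 `&` gambles_at F p.2, p.2).

Definition extend p := (closure_of p.1, p.2).

Lemma restrict_closed p : Psi F p -> tPsi F (restrict p).
Proof. by move=> Pp; exists p.2 => //; exists p.1 => //; exact: Psi_Phi. Qed.

(** The closure of a restriction to [x] is an extraction at [x], and extraction is idempotent. *)
Lemma extend_closed p : tPsi F p -> Psi F (extend p).
Proof.
case=> x _ [D _ <-]; exists x => //; exists (extract F x D) => //.
by split; [exact: Phi_extract|exact: extract_support].
Qed.

Lemma restrictK p : Psi F p -> extend (restrict p) = p.
Proof.
move=> /Psi_extract sp; rewrite /extend /= -[closure_of _]/(extract F p.2 p.1).
by rewrite sp -surjective_pairing.
Qed.

Lemma extendK p : tPsi F p -> restrict (extend p) = p.
Proof.
by case=> x _ [D PD <-]; rewrite /restrict /= extract_gambles_at.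
Qed.

(** By the support property, the closures inside [tPsi_combine] recover [p.1] and [q.1]. *)
Lemma restrict_combine p q : Psi F p -> Psi F q ->
  restrict (Psi_combine F p q) = tPsi_combine F (restrict p) (restrict q).
Proof.
move=> /Psi_extract sp /Psi_extract sq.
rewrite /restrict /tPsi_combine /=.
rewrite -[closure_of (p.1 `&` _)]/(extract F p.2 p.1).
by rewrite -[closure_of (q.1 `&` _)]/(extract F q.2 q.1) sp sq.
Qed.

Lemma restrict_transport y p : Psi F p ->
  restrict (Psi_transport F y p) = tPsi_transport F y (restrict p).
Proof.
move=> Pp; rewrite /restrict /tPsi_transport /=.
(* Both sides reduce to the part of [p.1] in [gambles_at F y]: here extraction at [y] is absorbed,
   then the support [p.2] removes the closure. *)
rewrite extract_gambles_at; last exact: Psi_Phi.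
by rewrite -[closure_of _]/(extract F p.2 p.1) Psi_extract.
Qed.

End Restriction.

Theorem theorem19 (R : realType) (Omega Q : Type) (F : question_family Omega Q) :
  exists h : Psi_algebra R F -> tPsi_algebra R F, labeled_iso h.
Proof.
(* Proof irrelevance reduces equations in the carriers to equations of the underlying pairs. *)
have sval_inj T (P : T -> Prop) (u v : {z | P z}) : sval u = sval v -> u = v.
  by apply: eq_sig_hprop => z; exact: Prop_irrelevance.
exists (fun u => exist _ (restrict F (sval u)) (restrict_closed F _ (svalP u))).
split=> [|//|u v|y u].
- exists (fun u => exist _ (extend (sval u)) (extend_closed F _ (svalP u))) => u.
    exact/sval_inj/restrictK/svalP.
  exact/sval_inj/extendK/svalP.
- by apply: sval_inj; apply: restrict_combine; exact: svalP.
- by apply: sval_inj; apply: restrict_transport; exact: svalP.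
Qed.
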